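(* Let $\xi$ and $\mu$ be infinitely divisible, non-negative real-valued random variables with finite, non-zero means. Write $\xi^{\mathrm s}\overset{d}{=}\xi+\eta$ with $\eta\ge 0$ independent of $\xi$, and $\mu^{\mathrm s}\overset{d}{=}\mu+\nu$ with $\nu\ge 0$ independent of $\mu$, where $^{\mathrm s}$ denotes the size-biased version. Let $Z\sim\mathrm{MP}(\xi)$ and $W\sim\mathrm{MP}(\mu)$ be mixed Poisson random variables. Then for every class $\mathcal{H}$ of functions $h:\mathbb{Z}^+\to\mathbb{R}$ (for which the expectations involved exist), $$\sup_{h\in\mathcal{H}}|\mathbb{E}h(W)-\mathbb{E}h(Z)|\leq(\mathbb{E}\xi)\,M_1^{(Z)}(\mathcal{H})\,d_{\mathrm W}(\nu,\eta)+M_0^{(Z)}(\mathcal{H})\,|\mathbb{E}\mu-\mathbb{E}\xi|\,.$$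
   Context: $\mathbb{Z}^+=\{0,1,2,\ldots\}$. Size-biasing: for a non-negative random variable $X$ with finite, non-zero mean, $X^{\mathrm s}$ denotes a random variable with $\mathbb{E}f(X^{\mathrm s})=\mathbb{E}[Xf(X)]/\mathbb{E}X$ for all $f:\mathbb{R}^+\to\mathbb{R}$ for which the right-hand side exists. It is known (Steutel) that $X$ is infinitely divisible if and only if $X^{\mathrm s}$ is equal in distribution to $X+Y$ for some non-negative random variable $Y$ independent of $X$. Mixed Poisson: $Z\sim\mathrm{MP}(\xi)$ means that, conditionally on $\xi$, $Z$ is Poisson with mean $\xi$, i.e. $\mathbb{P}(Z=j)=\mathbb{E}[e^{-\xi}\xi^j]/j!$ for $j\in\mathbb{Z}^+$. Wasserstein distance: $d_{\mathrm W}(X,X')=\sup\{|\mathbb{E}h(X)-\mathbb{E}h(X')|: |h(x)-h(y)|\le|x-y| \text{ for all } x,y\}=\int_{\mathbb{R}}|\mathbb{P}(X\le x)-\mathbb{P}(X'\le x)|\,dx$. Stein equation: for $h:\mathbb{Z}^+\to\mathbb{R}$, $f=f_h:\mathbb{Z}^+\to\mathbb{R}$ denotes the solution, with $f(0)=0$, of $$h(k)-\mathbb{E}h(Z)=\mathbb{E}\xi\sum_{i=1}^\infty\frac{1}{(i-1)!}\mathbb{E}[e^{-\eta}\eta^{i-1}]f(k+i)-kf(k),\qquad k\in\mathbb{Z}^+,$$ where ''the solution'' means the bounded solution (which is unique given $f(0)=0$) whenever a bounded solution exists. For a class $\mathcal{H}$, $$M_0^{(Z)}(\mathcal{H})=\sup_{h\in\mathcal{H}}\lVert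 f_h\rVert,\qquad M_1^{(Z)}(\mathcal{H})=\sup_{h\in\mathcal{H}}\lVert \Delta f_h\rVert,$$ where $\lVert g\rVert=\sup_x|g(x)|$ and $\Delta g(k)=g(k+1)-g(k)$. *)

(* Defs.v *)
From HB Require Import structures.
From mathcomp Require Import all_boot all_order all_algebra.
From mathcomp Require Import all_classical all_reals all_analysis.

Set Implicit Arguments.
Unset Strict Implicit.
Unset Printing Implicit Defensive.
Import Order.TTheory GRing.Theory Num.Theory.
Import numFieldNormedType.Exports.

Local Open Scope classical_set_scope.
Local Open Scope ring_scope.
Local Open Scope ereal_scope.

Definition finite_mean (R : realType) (d : measure_display)
    (T : measurableType d) (P : probability T R) (X : T -> R) : Prop :=
  P.-integrable [set: T] (EFin \o X).

(* Restricted to measurable A: a [probability] is a total function on sets,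
   with no meaningful value outside the sigma-algebra. *)
Definition eq_in_distribution (R : realType) (d d' : measure_display)
    (T : measurableType d) (P : probability T R) (X : T -> R)
    (T' : measurableType d') (P' : probability T' R) (X' : T' -> R) : Prop :=
  forall A : set R, measurable A -> P (X @^-1` A) = P' (X' @^-1` A).

Definition independent (R : realType) (d : measure_display)
    (T : measurableType d) (P : probability T R) (X Y : T -> R) : Prop :=
  forall A B : set R, measurable A -> measurable B ->
    P (X @^-1` A `&` Y @^-1` B) = P (X @^-1` A) * P (Y @^-1` B).

(* The product rule for subfamilies is the case where the other B i are
   [set: R]. *)
Definition mutually_independent (R : realType) (d : measure_display)
    (T : measurableType d) (P : probability T R) (n : nat)
    (X : 'I_n -> T -> R) : Prop :=
  forall B : 'I_n -> set R, (forall i, measurable (B i)) ->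
    P (\bigcap_(i in [set: 'I_n]) (X i @^-1` B i)) =
    \prod_(i < n) P (X i @^-1` B i).

Definition infinitely_divisible (R : realType) (d : measure_display)
    (T : measurableType d) (P : probability T R) (X : T -> R) : Prop :=
  forall n : nat, (0 < n)%N ->
  exists (d' : measure_display) (T' : measurableType d')
    (P' : probability T' R) (Y : 'I_n -> {RV P' >-> R}),
    [/\ mutually_independent P' (fun i => Y i : T' -> R),
        forall i j, eq_in_distribution P' (Y i) P' (Y j) &
        eq_in_distribution P X P' (fun t => \sum_(i < n) Y i t)%R].

(* Y has the law of X^s. Test functions of a non-negative variable are taken
   on all of R, which changes nothing when X and Y are non-negative. *)
Definition is_size_biased (R : realType) (d d' : measure_display)
    (T : measurableType d) (P : probability T R) (X : T -> R)
    (T' : measurableType d') (P' : probability T' R) (Y : T' -> R) : Prop :=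
  forall f : R -> R, measurable_fun [set: R] f ->
    finite_mean P (fun t => X t * f (X t))%R ->
    'E_P'[f \o Y] =
    (fine 'E_P[(fun t => X t * f (X t))%R] / fine 'E_P[X])%:E.

(* The library's poisson_pmf is not usable here: at rate 0 it is constantly 1,
   whereas the formula below correctly gives the unit mass at 0. *)
Definition mixed_poisson_pmf (R : realType) (d : measure_display)
    (T : measurableType d) (P : probability T R) (X : T -> R) (j : nat) : R :=
  (fine 'E_P[(fun t => expR (- X t) * X t ^+ j)%R] / (j`!)%:R)%R.

Definition mixed_poisson (R : realType) (d d' : measure_display)
    (T : measurableType d) (P : probability T R) (X : T -> R)
    (T' : measurableType d') (P' : probability T' R) (Z : T' -> nat) : Prop :=
  forall j : nat, P' (Z @^-1` [set j]) = (mixed_poisson_pmf P X j)%:E.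

(* The supremum is over the 1-Lipschitz h for which both expectations exist;
   this also makes sense when X or X' has infinite mean. *)
Definition wasserstein (R : realType) (d d' : measure_display)
    (T : measurableType d) (P : probability T R) (X : T -> R)
    (T' : measurableType d') (P' : probability T' R) (X' : T' -> R) : \bar R :=
  ereal_sup [set `| 'E_P[h \o X] - 'E_P'[h \o X'] | | h in
    [set h : R -> R | [/\ (forall x y, `|h x - h y| <= `|x - y|)%R,
                          finite_mean P (h \o X) &
                          finite_mean P' (h \o X')]]].

Definition supnorm (R : realType) (g : nat -> R) : \bar R :=
  ereal_sup (range (fun k => `|g k|%:E)).

Definition forward_diff (R : realType) (g : nat -> R) (k : nat) : R :=
  (g k.+1 - g k)%R.

(* The series over i >= 1 is indexed here by i - 1 and required to converge
   absolutely, as it stands for E f(k + 1 + N) with N ~ MP(eta); absolute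
   convergence is automatic for bounded f. *)
Definition stein_equation (R : realType) (d d' : measure_display)
    (T : measurableType d) (P : probability T R) (xi eta : T -> R)
    (T' : measurableType d') (P' : probability T' R) (Z : T' -> nat)
    (h f : nat -> R) : Prop :=
  forall k : nat,
    let u := fun i : nat =>
      (mixed_poisson_pmf P eta i * f (k + i.+1)%N)%R in
    cvgn [normed series u] /\
    (h k - fine 'E_P'[h \o Z] =
     fine 'E_P[xi] * limn (series u) - k%:R * f k)%R.

(* The candidates for f_h: all solutions vanishing at 0, except that only the
   bounded ones qualify as soon as there is one. *)
Definition stein_solutions (R : realType) (d d' : measure_display)
    (T : measurableType d) (P : probability T R) (xi eta : T -> R)
    (T' : measurableType d') (P' : probability T' R) (Z : T' -> nat)
    (h : nat -> R) : set (nat -> R) :=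
  let solves := fun f : nat -> R =>
    f 0%N = 0%R /\ stein_equation P xi eta P' Z h f in
  [set f | solves f /\
    ((exists g, solves g /\ supnorm g < +oo) -> supnorm f < +oo)].

(* When a bounded solution exists it is unique, so the infima below are just
   |f_h| and |Delta f_h|. When h has several unbounded solutions the infimum
   makes the factor as small as any choice of f_h would, and when h has no
   solution it is +oo. *)
Definition stein_factor0 (R : realType) (d d' : measure_display)
    (T : measurableType d) (P : probability T R) (xi eta : T -> R)
    (T' : measurableType d') (P' : probability T' R) (Z : T' -> nat)
    (H : set (nat -> R)) : \bar R :=
  ereal_sup [set ereal_inf
    [set supnorm f | f in stein_solutions P xi eta P' Z h] | h in H].

Definition stein_factor1 (R : realType) (d d' : measure_display)
    (T : measurableType d) (P : probability T R) (xi eta : T -> R)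
    (T' : measurableType d') (P' : probability T' R) (Z : T' -> nat)
    (H : set (nat -> R)) : \bar R :=
  ereal_sup [set ereal_inf
    [set supnorm (forward_diff f) | f in stein_solutions P xi eta P' Z h]
    | h in H].

(* Main.v *)
From HB Require Import structures.
Require Import Defs.
From mathcomp Require Import all_boot all_order all_algebra.
From mathcomp Require Import all_classical all_reals all_analysis.
From mathcomp Require Import measurable_realfun.
From mathcomp Require Import ring lra.
Set Implicit Arguments.
Unset Strict Implicit.
Unset Printing Implicit Defensive.
Import Order.TTheory GRing.Theory Num.Theory.
Import numFieldNormedType.Exports.
Local Open Scope classical_set_scope.
Local Open Scope ring_scope.

(** Let w, p_eta and p_nu be the mixed Poisson weights of mu, eta and nu, and
    let N_eta and N_nu be independent of W with weights p_eta and p_nu.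

    Testing the relation mu^s = mu + nu on the function x |-> e^{-x} x^k / k!
    turns it into (k+1) w(k+1) = E mu * (w * p_nu)(k), with a convolution on
    the right ([size_bias_recursion]); equivalently,
    E[W f(W)] = E mu * E f(W + 1 + N_nu).  Averaging the Stein equation of Z
    over the law of W therefore gives ([stein_identity])
      E h(W) - E h(Z) = E xi * E f(W + 1 + N_eta) - E mu * E f(W + 1 + N_nu).
    Put G(i) = E f(W + 1 + i).  The right-hand side is
      E xi * (E G(N_eta) - E G(N_nu)) + (E xi - E mu) * E G(N_nu),
    whose second term is at most |f| |E mu - E xi|.  For the first term,
    E G(N_eta) = E g(eta), where g(x) is the mean of G under the Poisson law of
    rate x.  The increments of G are bounded by |Delta f|, hence g is Lipschitz
    with the same constant: a Poisson variable of rate x + t is one of rate x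
    plus an independent one of mean t ([smooth_lip]).  So the first term is at
    most E xi * |Delta f| * d_W(nu, eta).

    Two points need care.  First, only Delta f is assumed bounded in the
    averaging step, while eta may have infinite mean.  Absolute convergence of
    the Stein series at k = 0 and bounded increments give
    E |f(k + 1 + N_eta)| <= A + C k; then the Stein equation itself bounds
    k |f(k)| by |h(k)| plus a linear function of k, both integrable under W.
    Secondly, the two Stein factors are separate infima over solutions.  There
    is at most one solution with bounded increments ([stein_unique]), so both
    are attained at it when it exists.  When it does not, both are infinite and
    only the case E mu = E xi, d_W(nu, eta) = 0 has content; then p_eta = p_nu,
    the recursion determines w, and W and Z have the same law. *)

(** * Absolutely convergent series *)

(** The product measure needs the counting measure as a sigma-finite measure,
    a structure that includes s-finiteness. *)
HB.instance Definition _ (R : realType) :=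
  Measure_isSigmaFinite.Build _ _ _ (@counting nat R) (sigma_finite_counting R).

Section sums.
Context {R : realType}.
Implicit Types u v : nat -> R.

Lemma measurable_fun_nat d (T : measurableType d) (f : nat -> T) :
  measurable_fun setT f.
Proof. by []. Qed.

(** Absolute convergence is encoded as integrability for the counting measure,
    so that linearity, comparison and Fubini are instances of Lebesgue
    integration. *)
Definition absum u : Prop := (@counting nat R).-integrable setT (EFin \o u).
Definition tsum u : R := \int[@counting nat R]_k u k.

Lemma absumP u : absum u <-> (\sum_(k <oo) `|u k|%:E < +oo)%E.
Proof.
rewrite /absum -ge0_integral_count//; split=> [/integrableP[]//|h].
by apply/integrableP; split.
Qed.

Lemma absum_cvg u : cvgn [normed series u] <-> absum u.
Proof.
rewrite absumP; split=> [h|h].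
  suff -> : (\sum_(k <oo) `|u k|%:E = (limn [normed series u])%:E)%E.
    exact: ltry.
  rewrite -EFin_lim//; apply: congr_lim; apply/funext => n /=.
  by rewrite /series/= sumEFin.
have sm : summable (fun=> true) (fun k => `|u k|%:E).
  rewrite /summable (_ : (fun=> is_true true) = setT) -?nneseries_esumT//=.
    by under eq_eseriesr do rewrite normr_id.
  exact/seteqP.
by have := @summable_cvg _ predT (fun k => `|u k|%:E)
  (fun _ _ => normr_ge0 _) sm.
Qed.

Lemma absum_is_cvg u : absum u -> cvgn (series u).
Proof. by move/absum_cvg/normed_cvg. Qed.

Lemma tsum_lim u : absum u -> limn (series u) = tsum u.
Proof.
move=> au; have cu := absum_is_cvg au.
rewrite /tsum /Rintegral integral_count; last first.
  rewrite /summable -nneseries_esumT//=.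
  exact/absumP.
suff -> : (\sum_(k <oo) (u k)%:E = (limn (series u))%:E)%E by [].
rewrite -EFin_lim//; apply: congr_lim; apply/funext => n /=.
by rewrite /series/= sumEFin.
Qed.

Lemma cvg_tsum u : absum u -> series u @ \oo --> tsum u.
Proof. by move=> au; rewrite -tsum_lim//; exact: absum_is_cvg. Qed.

Lemma le_absum u v : (forall k, `|u k| <= v k) -> absum v -> absum u.
Proof.
move=> uv; apply: le_integrable => // k _ /=.
by rewrite lee_fin (le_trans (uv k))// ler_norm.
Qed.

Lemma absum_norm u : absum u -> absum (fun k => `|u k|).
Proof. exact: integrable_norm. Qed.

Lemma absumD u v : absum u -> absum v -> absum (fun k => u k + v k).
Proof. by move=> au av; have := integrableD measurableT au av. Qed.

Lemma absumZ c u : absum u -> absum (fun k => c * u k).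
Proof. by move=> au; have := integrableZl measurableT c au. Qed.

Lemma absumB u v : absum u -> absum v -> absum (fun k => u k - v k).
Proof. by move=> au av; have := integrableB measurableT au av. Qed.

Lemma tsumD u v : absum u -> absum v ->
  tsum (fun k => u k + v k) = tsum u + tsum v.
Proof. by move=> au av; exact: RintegralD. Qed.

Lemma tsumB u v : absum u -> absum v ->
  tsum (fun k => u k - v k) = tsum u - tsum v.
Proof. by move=> au av; exact: RintegralB. Qed.

Lemma tsumZ c u : absum u -> tsum (fun k => c * u k) = c * tsum u.
Proof. by move=> au; exact: RintegralZl. Qed.

Lemma le_tsum u v : absum u -> absum v -> (forall k, u k <= v k) ->
  tsum u <= tsum v.
Proof. by move=> au av uv; exact: le_Rintegral. Qed.

Lemma tsum_ge0 u : (forall k, 0 <= u k) -> 0 <= tsum u.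
Proof. by move=> u0; exact: Rintegral_ge0. Qed.

Lemma norm_tsum u : absum u -> `|tsum u| <= tsum (fun k => `|u k|).
Proof. by move=> au; exact: le_normr_Rintegral. Qed.

Lemma EFin_tsum u : absum u ->
  (tsum u)%:E = (\int[@counting nat R]_k (u k)%:E)%E.
Proof.
by move=> au; rewrite /tsum /Rintegral fineK//; exact: integrable_fin_num.
Qed.

Lemma absum_finite n u : (forall k, (n <= k)%N -> u k = 0) -> absum u.
Proof.
move=> u0; apply/absumP.
rewrite (nneseries_split 0 n)//= add0n.
rewrite eseries0 ?adde0//; last by move=> k nk _; rewrite u0 ?normr0.
by rewrite sumEFin ltry.
Qed.

Lemma tsum_finite n u : (forall k, (n <= k)%N -> u k = 0) ->
  tsum u = \sum_(k < n) u k.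
Proof.
move=> u0; rewrite -tsum_lim; last exact: absum_finite u0.
apply/cvg_lim => //; apply: (@cvg_near_cst _ _ (\sum_(k < n) u k)).
near=> m; rewrite /series/= (@big_cat_nat _ _ _ n)//=; last first.
  by near: m; exact: nbhs_infty_ge.
rewrite big_mkord [X in _ + X]big_nat [X in _ + X]big1 ?addr0//.
by move=> k /andP[nk _]; exact: u0.
Unshelve. all: by end_near. Qed.

Lemma absumS u : absum u -> absum (fun k => u k.+1).
Proof.
move=> /absumP au; apply/absumP; apply: le_lt_trans au.
rewrite [leRHS](nneseries_split 0 1)//= add0n big_nat1.
rewrite -(@nneseries_addn _ (fun k => `|u k|%:E)%E 1)//.
by under [X in (_ <= _ + X)%E]eq_eseriesr do rewrite addn1; rewrite leeDr.
Qed.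

Lemma absum_S u : absum (fun k => u k.+1) -> absum u.
Proof.
move=> /absumP au; apply/absumP.
rewrite (nneseries_split 0 1)//= add0n big_nat1 lte_add_pinfty ?ltry//.
rewrite -(@nneseries_addn _ (fun k => `|u k|%:E)%E 1)//.
by under eq_eseriesr do rewrite addn1.
Qed.

Lemma tsumS u : absum u -> tsum u = u 0%N + tsum (fun k => u k.+1).
Proof.
move=> au; rewrite -tsum_lim//; apply/cvg_lim => //.
rewrite -(cvg_shiftS (series u)) /=.
under eq_fun do rewrite /series/= big_nat_recl//.
by apply: cvgD; [exact: cvg_cst|exact/cvg_tsum/absumS].
Qed.

Lemma absum_shift i u : absum (fun k => u (i + k)%N) <-> absum u.
Proof.
elim: i u => [//|i IH] u; apply: iff_trans (IH (fun k => u k.+1)) _.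
by split; [exact: absum_S|exact: absumS].
Qed.

Lemma tsum_shift i u : absum u -> (forall k, (k < i)%N -> u k = 0) ->
  tsum u = tsum (fun k => u (i + k)%N).
Proof.
elim: i u => [//|i IH] u au u0.
rewrite tsumS// u0// add0r IH//; first exact: absumS.
by move=> k ki; exact: u0.
Qed.

End sums.

(** * Exchange of sums and integrals *)

Section fubini_count.
Context {R : realType} d (T : measurableType d)
  (m : {sigma_finite_measure set T -> \bar R}).

(** A measurable set of T * nat is a countable union of slices, so no joint
    measurability has to be checked. *)
Lemma measurable_fun_slices d' (T' : measurableType d') (F : T * nat -> T') :
  (forall k, measurable_fun setT (fun t => F (t, k))) -> measurable_fun setT F.
Proof.
move=> mF _ Y mY; rewrite setTI.
have -> : F @^-1` Y = \bigcup_k (((fun t => F (t, k)) @^-1` Y) `*` [set k]).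
  apply/seteqP; split=> [[t k] /= FY|[t k] [k' _ [/= FY ->]]] //.
  by exists k.
apply: bigcup_measurable => k _; apply: measurableX => //.
by rewrite -[X in measurable X]setTI; exact: mF.
Qed.

Variable F : T -> nat -> R.
Hypothesis mF : forall k, measurable_fun setT (F ^~ k).
Hypothesis aF : forall t, absum (F t).

Let f (z : T * nat) : \bar R := (F z.1 z.2)%:E.

Let mf : measurable_fun setT f.
Proof.
by apply: measurable_fun_slices => k; apply/measurable_EFinP; exact: mF.
Qed.

(** Every row t |-> F t is assumed summable, not only almost every one, so that
    the row sums are genuine for all t. *)
Lemma Fubini_count :
  m.-integrable setT (EFin \o (fun t => tsum (fun k => `|F t k|))) ->
  [/\ forall k, m.-integrable setT (EFin \o (F ^~ k)),
      m.-integrable setT (EFin \o (fun t => tsum (F t))),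
      absum (fun k => \int[m]_t F t k) &
      \int[m]_t tsum (F t) = tsum (fun k => \int[m]_t F t k)].
Proof.
move=> /integrableP[_ hF].
have If : (m \x @counting nat R)%E.-integrable setT f.
  apply/(integrable12ltyP _ _ mf); apply: le_lt_trans hF.
  rewrite le_eqVlt; apply/orP; left; apply/eqP; apply: eq_integral => t _ /=.
  rewrite ger0_norm ?tsum_ge0// EFin_tsum//; exact: absum_norm.
have iF k : m.-integrable setT (EFin \o (F ^~ k)).
  apply/integrableP; split; first exact/measurable_EFinP.
  have := (integrable21ltyP _ _ mf).1 If.
  rewrite ge0_integral_count; last by move=> j; exact: integral_ge0.
  apply: le_lt_trans; rewrite (@nneseriesD1 _ _ k)//; last first.
    by move=> j _; exact: integral_ge0.
  by rewrite leeDl// nneseries_ge0// => j _ _; exact: integral_ge0.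
have EF : fubini_F (@counting nat R) f = EFin \o (fun t => tsum (F t)).
  by apply/funext => t; rewrite /fubini_F /= EFin_tsum.
have EG : fubini_G m f = EFin \o (fun k => \int[m]_t F t k)%R.
  apply/funext => t; rewrite /fubini_G /= /Rintegral fineK//.
  exact: (integrable_fin_num measurableT (iF t)).
split => //.
- by rewrite -EF; exact: integrable_fubini_F.
- apply/integrableP; split=> //.
  apply: le_lt_trans ((integrable21ltyP _ _ mf).1 If).
  apply: ge0_le_integral => //= k _.
  rewrite (EFin_normr_Rintegral measurableT (iF k)).
  apply: (le_abse_integral m measurableT).
  exact: measurable_int (iF k).
- have h := Fubini If; rewrite /tsum /Rintegral; congr fine.
  transitivity (\int[m]_x fubini_F (@counting nat R) f x)%E.
    by rewrite EF.
  transitivity (\int[@counting nat R]_y fubini_G m f y)%E; first exact: h.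
  by rewrite EG.
Qed.

(** Supplies the hypothesis of [Fubini_count] from a bound on the columns. *)
Lemma tonelli_count :
  (forall k, m.-integrable setT (EFin \o (F ^~ k))) ->
  absum (fun k => \int[m]_t `|F t k|) ->
  m.-integrable setT (EFin \o (fun t => tsum (fun k => `|F t k|))).
Proof.
move=> iF /integrableP[_ hF].
have If : (\int[m]_x \int[@counting nat R]_y `|f (x, y)| < +oo)%E.
  apply/(integrable12ltyP _ _ mf)/(integrable21ltyP _ _ mf).
  apply: le_lt_trans hF; rewrite le_eqVlt; apply/orP; left; apply/eqP.
  apply: eq_integral => k _ /=.
  rewrite ger0_norm ?Rintegral_ge0// /Rintegral fineK//.
  exact: (integrable_fin_num measurableT (integrable_norm (iF k))).
have EA : (fun x => (\int[@counting nat R]_y `|f (x, y)|)%E) =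
    EFin \o (fun t => tsum (fun k => `|F t k|)).
  by apply/funext => t; rewrite /= EFin_tsum//; exact: absum_norm.
apply/integrableP; split.
  rewrite -EA; apply: (measurable_fun_fubini_tonelli_F (abse \o f)).
    exact: measurableT_comp.
  by move=> x; exact: abse_ge0.
apply: le_lt_trans If; rewrite -EA le_eqVlt; apply/orP; left; apply/eqP.
by apply: eq_integral => t _; rewrite gee0_abs// integral_ge0.
Qed.

End fubini_count.

(** * Double series and convolution *)

Section double_sums.
Context {R : realType}.
Implicit Types (a b F : nat -> R) (K : nat -> nat -> R).

(** The row-wise form of summability over pairs; symmetric in the two indices by
    [exchange_tsum]. *)
Definition absum2 K : Prop :=
  (forall i, absum (K i)) /\ absum (fun i => tsum (fun j => `|K i j|)).

Lemma absum2_norm K : absum2 K -> absum2 (fun i j => `|K i j|).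
Proof.
move=> [aK sK]; split=> [i|]; first exact: absum_norm.
by under [X in absum X]eq_fun do under eq_fun do rewrite normr_id.
Qed.

Lemma absum2_tsum K : absum2 K -> absum (fun i => tsum (K i)).
Proof. by move=> [aK sK]; apply: le_absum sK => i; exact: norm_tsum. Qed.

Lemma exchange_tsum K : absum2 K ->
  absum2 (fun j i => K i j) /\
  tsum (fun i => tsum (K i)) = tsum (fun j => tsum (fun i => K i j)).
Proof.
move=> K2; have [aK sK] := K2; have [aN sN] := absum2_norm K2.
have mK (L : nat -> nat -> R) k := measurable_fun_nat (L ^~ k).
have [cK _ _ E] := Fubini_count (m := @counting nat R) (mK _) aK sK.
have [_ _ dK _] := Fubini_count (m := @counting nat R) (mK _) aN sN.
by split.
Qed.

Definition conv a b (n : nat) : R := \sum_(i < n.+1) a (n - i)%N * b i.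

Lemma conv_ge0 a b n : (forall k, 0 <= a k) -> (forall k, 0 <= b k) ->
  0 <= conv a b n.
Proof. by move=> a0 b0; apply: sumr_ge0 => i _; exact: mulr_ge0. Qed.

(** The substitution n = i + j in a double series over (i, j) leaves terms on
    the triangle i <= n, extended by zero to all pairs. *)
Let V a b F (i n : nat) : R :=
  if (i <= n)%N then a (n - i)%N * b i * F n else 0.

Let V_shift a b F i j : V a b F i (i + j)%N = a j * b i * F (j + i)%N.
Proof. by rewrite /V leq_addr addKn addnC. Qed.

Let absum_V a b F i :
  absum (V a b F i) <-> absum (fun j => a j * b i * F (j + i)%N).
Proof.
apply: iff_trans (iff_sym (absum_shift i _)) _.
by under eq_fun do rewrite V_shift.
Qed.

Let tsum_V a b F i : absum (V a b F i) ->
  tsum (V a b F i) = tsum (fun j => a j * b i * F (j + i)%N).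
Proof.
move=> aV; rewrite (tsum_shift (i := i) aV) => [|k ki]; last first.
  by rewrite /V leqNgt ki.
by under eq_fun do rewrite V_shift.
Qed.

Let norm_V a b F i n : (forall k, 0 <= a k) -> (forall k, 0 <= b k) ->
  `|V a b F i n| = V a b (fun k => `|F k|) i n.
Proof.
move=> a0 b0; rewrite /V; case: ifP => _; last by rewrite normr0.
by rewrite normrM ger0_norm// mulr_ge0.
Qed.

Let V_col a b F n : absum (fun i => V a b F i n) /\
  tsum (fun i => V a b F i n) = conv a b n * F n.
Proof.
have V0 k : (n.+1 <= k)%N -> V a b F k n = 0 by move=> nk; rewrite /V leqNgt nk.
split; first exact: absum_finite V0.
rewrite (tsum_finite V0) /conv mulr_suml; apply: eq_bigr => i _.
by rewrite /V -ltnS ltn_ord.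
Qed.

Let absum2_V a b F : (forall k, 0 <= a k) -> (forall k, 0 <= b k) ->
  absum2 (V a b F) <-> absum2 (fun i j => a j * b i * F (j + i)%N).
Proof.
move=> a0 b0.
have VN i : absum (V a b F i) -> tsum (fun n => `|V a b F i n|) =
    tsum (fun j => `|a j * b i * F (j + i)%N|).
  move=> aV; under eq_fun do rewrite norm_V//.
  rewrite tsum_V; last by rewrite (_ : V _ _ _ _ = fun n => `|V a b F i n|);
    [exact: absum_norm|apply/funext => n; rewrite norm_V].
  by congr tsum; apply/funext => j; rewrite normrM [in RHS]ger0_norm// mulr_ge0.
split=> -[aK sK]; have aV i := (absum_V a b F i).
  split=> [i|]; first exact/aV.
  by under eq_fun do rewrite -VN//.
have aV' i : absum (V a b F i) by exact/aV.
by split=> //; under eq_fun do rewrite VN//.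
Qed.

(** This equivalence is used both ways: it transfers summability of a
    convolution to the double series, where nothing else is known, and
    conversely. *)
Lemma absum_conv a b F : (forall k, 0 <= a k) -> (forall k, 0 <= b k) ->
  absum (fun n => conv a b n * F n) <->
  absum2 (fun i j => a j * b i * F (j + i)%N).
Proof.
move=> a0 b0; split=> [h|].
  apply/absum2_V => //.
  suff : absum2 (fun n i => V a b F i n) by move=> /exchange_tsum[].
  split=> [n|]; first by have [] := V_col a b F n.
  under eq_fun do under eq_fun do rewrite norm_V//.
  have -> : (fun n => tsum (fun i => V a b (fun k => `|F k|) i n)) =
      fun n => `|conv a b n * F n|.
    apply/funext => n; have [_ ->] := V_col a b (fun k => `|F k|) n.
    by rewrite normrM (ger0_norm (conv_ge0 _ _ _)).
  exact: absum_norm.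
move=> /(absum2_V F a0 b0) hV; have [hV' _] := exchange_tsum hV.
have -> : (fun n => conv a b n * F n) = (fun n => tsum (fun i => V a b F i n)).
  by apply/funext => n; have [_ ->] := V_col a b F n.
exact: absum2_tsum hV'.
Qed.

Lemma tsum_conv a b F : (forall k, 0 <= a k) -> (forall k, 0 <= b k) ->
  absum (fun n => conv a b n * F n) ->
  tsum (fun n => conv a b n * F n) =
  tsum (fun i => tsum (fun j => a j * b i * F (j + i)%N)).
Proof.
move=> a0 b0 h; have hV : absum2 (V a b F) by exact/absum2_V/absum_conv.
have [_ E] := exchange_tsum hV.
transitivity (tsum (fun i => tsum (V a b F i))).
  by rewrite E; congr tsum; apply/funext => n; have [_ ->] := V_col a b F n.
by congr tsum; apply/funext => i; rewrite tsum_V//; have [] := hV.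
Qed.

End double_sums.

(** * Poisson weights and Poisson averages *)

Section poisson.
Context {R : realType}.
Implicit Types (x y t C : R) (a G : nat -> R).

(** The weights make sense for all real x, and at x = 0 they are the unit mass
    at 0. *)
Definition pois x (k : nat) : R := expR (- x) * x ^+ k / k`!%:R.

Lemma pois_ge0 x k : 0 <= x -> 0 <= pois x k.
Proof. by move=> x0; rewrite divr_ge0// mulr_ge0 ?expR_ge0 ?exprn_ge0. Qed.

Lemma poisE x k : pois x k = expR (- x) * exp_coeff x k.
Proof. by rewrite /pois /exp_coeff mulrA. Qed.

Lemma absum_pois x : absum (pois x).
Proof.
rewrite (_ : pois x = fun k => expR (- x) * exp_coeff x k); last first.
  by apply/funext => k; exact: poisE.
apply/absumZ/absum_cvg.
rewrite (_ : [normed series _] = series (exp_coeff `|x|)).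
  exact: is_cvg_series_exp_coeff.
apply/funext => n; apply: eq_bigr => i _.
by rewrite /exp_coeff /= normrM normrX normfV normr_nat.
Qed.

Lemma absum_exp_coeff x : absum (exp_coeff x).
Proof.
have := absumZ (expR x) (absum_pois x); congr absum.
by apply/funext => k; rewrite poisE mulrA -expRD subrr expR0 mul1r.
Qed.

Lemma tsum_pois x : tsum (pois x) = 1.
Proof.
rewrite (_ : pois x = fun k => expR (- x) * exp_coeff x k); last first.
  by apply/funext => k; exact: poisE.
rewrite tsumZ; last exact: absum_exp_coeff.
have -> : tsum (fun k => exp_coeff x k) = expR x.
  exact/esym/(tsum_lim (absum_exp_coeff x)).
by rewrite -expRD addNr expR0.
Qed.

(** Additivity of independent Poisson variables: the binomial formula. *)
Lemma conv_pois x y : conv (pois x) (pois y) = pois (x + y).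
Proof.
apply/funext => n; rewrite /conv /pois exprDn opprD expRD mulr_sumr mulr_suml.
apply: eq_bigr => i _; have lein : (i <= n)%N by rewrite -ltnS ltn_ord.
rewrite -mulr_natr -!mulrA -[in RHS](bin_fact lein) !natrM.
have h k : k`!%:R != 0 :> R by rewrite pnatr_eq0 -lt0n fact_gt0.
have c0 : 'C(n, i)%:R != 0 :> R by rewrite pnatr_eq0 -lt0n bin_gt0.
by field; rewrite !h c0.
Qed.

Lemma poisS x k : k.+1%:R * pois x k.+1 = x * pois x k.
Proof.
rewrite /pois factS natrM exprS.
have h : k`!%:R != 0 :> R by rewrite pnatr_eq0 -lt0n fact_gt0.
have hk : k.+1%:R != 0 :> R by rewrite pnatr_eq0.
move: hk; rewrite -natr1 => hk; by field; rewrite h hk.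
Qed.

Lemma absum_pois_mean x : absum (fun k => k%:R * pois x k).
Proof.
apply: absum_S; under eq_fun do rewrite poisS.
exact/absumZ/absum_pois.
Qed.

Lemma tsum_pois_mean x : tsum (fun k => k%:R * pois x k) = x.
Proof.
rewrite tsumS; last exact: absum_pois_mean.
rewrite mul0r add0r.
under eq_fun do rewrite poisS.
by rewrite tsumZ ?tsum_pois ?mulr1//; exact: absum_pois.
Qed.

Definition lipseq C G := forall k, `|G k.+1 - G k| <= C.

Lemma lipseq_ge0 C G : lipseq C G -> 0 <= C.
Proof. by move=> /(_ 0%N); exact: le_trans. Qed.

Lemma lipseq_dist C G n k : lipseq C G -> `|G (n + k)%N - G n| <= C * k%:R.
Proof.
move=> GC; elim: k => [|k IH]; first by rewrite addn0 subrr normr0 mulr0.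
rewrite addnS -(subrK (G (n + k)%N) (G (n + k).+1)) -addrA.
rewrite (le_trans (ler_normD _ _))// -natr1 mulrDr mulr1 [leRHS]addrC lerD//.
Qed.

Lemma lipseq_growth C G n : lipseq C G -> `|G n| <= `|G 0%N| + C * n%:R.
Proof.
move=> GC; rewrite -(subrK (G 0%N) (G n)) (le_trans (ler_normD _ _))//.
rewrite [leRHS]addrC lerD//.
exact: (lipseq_dist 0).
Qed.

(** The mean of G under the Poisson law of rate x. *)
Definition poisson_smooth G x := tsum (fun k => pois x k * G k).

Lemma absum_lipseq C G a : lipseq C G -> (forall k, 0 <= a k) -> absum a ->
  absum (fun k => k%:R * a k) -> absum (fun k => a k * G k).
Proof.
move=> GC a0 aa am.
have := absumD (absumZ `|G 0%N| aa) (absumZ C am); apply: le_absum => k.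
rewrite normrM ger0_norm// mulrA -mulrDl mulrC ler_wpM2r//.
exact: lipseq_growth.
Qed.

Lemma absum_smooth C G x : 0 <= x -> lipseq C G ->
  absum (fun k => pois x k * G k).
Proof.
move=> x0 GC; apply: absum_lipseq GC _ (absum_pois x) (absum_pois_mean x) => k.
exact: pois_ge0.
Qed.

Lemma smoothD C G x t : 0 <= x -> 0 <= t -> lipseq C G ->
  poisson_smooth G (x + t) =
  tsum (fun i => tsum (fun j => pois x j * pois t i * G (j + i)%N)).
Proof.
move=> x0 t0 GC; rewrite /poisson_smooth -conv_pois; apply: tsum_conv => [k|k|].
- exact: pois_ge0.
- exact: pois_ge0.
- by rewrite conv_pois; apply: absum_smooth GC; exact: addr_ge0.
Qed.

(** Realise rate x + t as the sum of independent Poisson variables of rates x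
    and t: the second one moves the argument of G by t on average. *)
Lemma smooth_lip_step C G x t : 0 <= x -> 0 <= t -> lipseq C G ->
  `|poisson_smooth G (x + t) - poisson_smooth G x| <= C * t.
Proof.
move=> x0 t0 GC.
pose K i j := pois x j * pois t i * G (j + i)%N.
have [aK sK] : absum2 K.
  apply/absum_conv => [k|k|]; try exact: pois_ge0.
  by rewrite conv_pois; apply: absum_smooth GC; exact: addr_ge0.
rewrite (smoothD x0 t0 GC) -/(K _ _).
have -> : poisson_smooth G x = tsum (fun i => pois t i * poisson_smooth G x).
  under eq_fun do rewrite mulrC.
  by rewrite tsumZ ?tsum_pois ?mulr1//; exact: absum_pois.
have sG : absum (fun i => pois t i * poisson_smooth G x).
  by under eq_fun do rewrite mulrC; exact/absumZ/absum_pois.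
have saK : absum (fun i => tsum (K i)) by exact: absum2_tsum.
rewrite -tsumB//; apply: (le_trans (norm_tsum (absumB saK sG))).
rewrite -[leRHS](_ : tsum (fun i => C * (i%:R * pois t i)) = _); last first.
  by rewrite tsumZ ?tsum_pois_mean//; exact: absum_pois_mean.
apply: le_tsum => [||i]; first exact/absum_norm/absumB.
  exact/absumZ/absum_pois_mean.
have ax : absum (fun j => pois t i * (pois x j * G j)).
  exact/absumZ/(absum_smooth x0 GC).
have -> : pois t i * poisson_smooth G x =
    tsum (fun j => pois t i * (pois x j * G j)).
  by rewrite tsumZ//; exact: absum_smooth GC.
rewrite -tsumB//.
apply: (le_trans (norm_tsum (absumB (aK i) ax))).
rewrite -[leRHS](_ : tsum (fun j => C * i%:R * pois t i * pois x j) = _);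
    last first.
  by rewrite tsumZ ?tsum_pois ?mulr1 ?mulrA//; exact: absum_pois.
apply: le_tsum => [||j]; first exact/absum_norm/absumB.
  exact/absumZ/absum_pois.
rewrite /K (_ : _ - _ = pois t i * pois x j * (G (j + i)%N - G j)); last first.
  by ring.
have p0 : 0 <= pois t i * pois x j.
  by apply: mulr_ge0; exact: pois_ge0.
rewrite normrM ger0_norm//.
rewrite [leRHS](_ : _ = pois t i * pois x j * (C * i%:R)); last by ring.
by apply: ler_wpM2l => //; exact: lipseq_dist GC.
Qed.

Lemma smooth_lip C G x y : 0 <= x -> 0 <= y -> lipseq C G ->
  `|poisson_smooth G x - poisson_smooth G y| <= C * `|x - y|.
Proof.
move=> x0 y0 GC.
have step u v : 0 <= u -> u <= v ->
    `|poisson_smooth G v - poisson_smooth G u| <= C * `|v - u|.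
  move=> u0 uv; have vu : 0 <= v - u by rewrite subr_ge0.
  have := smooth_lip_step u0 vu GC.
  by rewrite [u + _]addrC subrK (ger0_norm vu).
have [xy|/ltW yx] := leP x y; last exact: step.
by rewrite distrC (distrC x); exact: step.
Qed.

End poisson.

(** * Expectations and independence *)

Lemma fine_expectation {R : realType} d (T : measurableType d)
  (P : probability T R) (X : T -> R) : fine 'E_P[X]%E = \int[P]_t X t.
Proof. by rewrite unlock. Qed.

Lemma expectation_EFin {R : realType} d (T : measurableType d)
  (P : probability T R) (X : T -> R) : finite_mean P X ->
  'E_P[X]%E = (\int[P]_t X t)%:E.
Proof.
move=> iX; rewrite unlock /Rintegral fineK//.
exact: (integrable_fin_num measurableT iX).
Qed.

Lemma Rintegral_prob_cst {R : realType} d (T : measurableType d)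
  (P : probability T R) (c : R) : \int[P]_t c = c.
Proof.
rewrite Rintegral_cst; last exact: measurableT.
by rewrite [X in fine X](_ : _ = 1%E) ?mulr1//; exact: probability_setT.
Qed.

Lemma mean_gt0 {R : realType} d (T : measurableType d)
    (P : probability T R) (X : T -> R) :
  (forall t, 0 <= X t)%R -> finite_mean P X -> 'E_P[X]%E != 0%E ->
  exists2 l : R, (0 < l)%R & 'E_P[X]%E = l%:E.
Proof.
move=> X0 iX; rewrite expectation_EFin// => l0; exists (\int[P]_t X t)%R => //.
by rewrite lt0r Rintegral_ge0 ?andbT.
Qed.

Section independence.
Context {R : realType} d (T : measurableType d) (P : probability T R).

(** The joint law of independent variables is the product of their laws, because
    both agree on rectangles; then Tonelli. *)
Lemma independent_integralM (X Y : {RV P >-> R}) (u v : R -> R) :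
  independent P X Y -> measurable_fun setT u -> measurable_fun setT v ->
  (forall x, 0 <= u x) -> (forall x, 0 <= v x) ->
  (\int[P]_t (u (X t) * v (Y t))%:E =
   \int[P]_t (u (X t))%:E * \int[P]_t (v (Y t))%:E)%E.
Proof.
move=> XY mu mv u0 v0.
have mXY : measurable_fun setT (fun t => (X t, Y t)).
  exact: measurable_fun_pair.
pose Z : {RV P >-> (R * R)%type} :=
  HB.pack (fun t => (X t, Y t)) (isMeasurableFun.Build _ _ _ _ _ mXY).
pose f (z : R * R) : \bar R := (u z.1 * v z.2)%:E.
have mf : measurable_fun setT f.
  by apply/measurable_EFinP; apply: measurable_funM; exact: measurableT_comp.
have f0 z : (0 <= f z)%E by rewrite lee_fin mulr_ge0.
transitivity (\int[distribution P Z]_z f z)%E.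
  by rewrite ge0_integral_distribution.
transitivity (\int[(distribution P X \x distribution P Y)%E]_z f z)%E.
  apply: eq_measure_integral => A mA _; apply/esym.
  apply: product_measure_unique; last exact: mA.
  by move=> B C mB mC; exact: XY.
rewrite fubini_tonelli1// /fubini_F /f /=.
have E (X' : {RV P >-> R}) (w : R -> R) :
    measurable_fun setT w -> (forall x, 0 <= w x) ->
    (\int[P]_t (w (X' t))%:E = \int[distribution P X']_x (w x)%:E)%E.
  move=> mw w0; apply/esym.
  apply: (@ge0_integral_distribution _ _ _ _ _ P X' (EFin \o w)).
    exact/measurable_EFinP.
  by move=> y; rewrite lee_fin.
rewrite !E//; rewrite muleC -ge0_integralZl//.
- apply: eq_integral => x _; rewrite muleC -ge0_integralZl//.
  + exact/measurable_EFinP.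
  + by move=> y _; rewrite lee_fin.
  + by rewrite lee_fin.
- exact/measurable_EFinP.
- by move=> y _; rewrite lee_fin.
- by apply: integral_ge0 => y _; rewrite lee_fin.
Qed.

End independence.

(** * Mixed Poisson weights *)

Section mixed_poisson.
Context {R : realType} d (T : measurableType d) (P : probability T R).
Variable X : {RV P >-> R}.
Hypothesis X0 : forall t, 0 <= X t.

Lemma measurable_pois k : measurable_fun setT (fun x : R => pois x k).
Proof.
apply: measurable_funM => //; apply: measurable_funM => //.
exact: measurableT_comp.
Qed.

Lemma measurable_poisX k : measurable_fun setT (fun t => pois (X t) k).
Proof. exact: measurableT_comp (measurable_pois k) _. Qed.

Lemma pois_le1 (x : R) k : 0 <= x -> pois x k <= 1.
Proof.
move=> x0; rewrite poisE expRN mulrC ler_pdivrMr ?expR_gt0// mul1r.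
case: k => [|k].
  by rewrite /exp_coeff/= expr0 fact0 divr1 -expR0 ler_expR.
by apply: le_trans (expR_ge1Dxn k x0); rewrite lerDr.
Qed.

Lemma integrable_pois k : P.-integrable setT (EFin \o (fun t => pois (X t) k)).
Proof.
apply: (le_integrable measurableT _ _ (finite_measure_integrable_cst P 1 measurableT)).
  exact/measurable_EFinP/measurable_poisX.
by move=> t _; rewrite /= lee_fin normr1 ger0_norm ?pois_le1// pois_ge0.
Qed.

Local Notation mp := (mixed_poisson_pmf P X).

Lemma mixed_poisson_pmfE k : mp k = \int[P]_t pois (X t) k.
Proof.
have k0 : k`!%:R != 0 :> R by rewrite pnatr_eq0 -lt0n fact_gt0.
rewrite /mixed_poisson_pmf unlock -/(Rintegral P setT _).
under eq_Rintegral => t _ do rewrite -[_ * _](divfK k0) -/(pois (X t) k).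
by rewrite RintegralZr ?mulfK//; exact: integrable_pois.
Qed.

Lemma mixed_poisson_pmf_ge0 k : 0 <= mp k.
Proof.
by rewrite mixed_poisson_pmfE; apply: Rintegral_ge0 => t _; exact: pois_ge0.
Qed.

(** Integrate the identity that the Poisson weights have sum 1. *)
Lemma mixed_poisson_total : absum mp /\ tsum mp = 1.
Proof.
have -> : mp = fun k => \int[P]_t pois (X t) k.
  by apply/funext => k; exact: mixed_poisson_pmfE.
have [||_ _ aP E] :=
  @Fubini_count R _ _ P (fun t => pois (X t)) measurable_poisX.
- by move=> t; exact: absum_pois.
- apply: eq_integrable (finite_measure_integrable_cst P 1 measurableT) => // t _ /=.
  by under eq_fun do rewrite ger0_norm ?pois_ge0//; rewrite tsum_pois.
- split=> //; rewrite -E; under eq_Rintegral do rewrite tsum_pois.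
  exact: Rintegral_prob_cst.
Qed.

(** Conditioning on the random rate X. The variable X may have infinite mean, so
    summability against its weights is a hypothesis. *)
Lemma mixed_poisson_smooth C G : lipseq C G -> absum (fun k => mp k * G k) ->
  P.-integrable setT (EFin \o (fun t => poisson_smooth G (X t))) /\
  \int[P]_t poisson_smooth G (X t) = tsum (fun k => mp k * G k).
Proof.
move=> GC aG; pose F t k := pois (X t) k * G k.
have mF k : measurable_fun setT (F ^~ k).
  by apply: measurable_funM => //; exact: measurable_poisX.
have aF t : absum (F t) by exact: absum_smooth GC.
have iF k : P.-integrable setT (EFin \o (F ^~ k)).
  have := integrableZl measurableT (G k) (integrable_pois k).
  by apply: eq_integrable => // t _; rewrite /F /= mulrC.
have EF k : \int[P]_t F t k = mp k * G k.
  by rewrite RintegralZr ?mixed_poisson_pmfE//; exact: integrable_pois.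
have ENF k : \int[P]_t `|F t k| = `|mp k * G k|.
  under eq_Rintegral => t _ do rewrite normrM (ger0_norm (pois_ge0 _ _))//.
  rewrite RintegralZr//; last exact: integrable_pois.
  by rewrite -mixed_poisson_pmfE normrM (ger0_norm (mixed_poisson_pmf_ge0 k)).
have aN : absum (fun k => \int[P]_t `|F t k|).
  by under eq_fun do rewrite ENF; exact: absum_norm.
have [_ iS _ ES] := Fubini_count mF aF (tonelli_count mF aF iF aN).
by split=> //; rewrite /poisson_smooth ES; congr tsum; apply/funext.
Qed.

End mixed_poisson.

(** * Size bias as a recursion on the weights *)

Section size_bias.
Context {R : realType} d (T : measurableType d) (P : probability T R).
Variables X Y : {RV P >-> R}.
Hypothesis X0 : forall t, 0 <= X t.
Hypothesis Y0 : forall t, 0 <= Y t.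

(** Poisson weights of X + Y are convolutions of those of X and Y; independence
    splits each product. *)
Lemma mixed_poisson_conv k : independent P X Y ->
  \int[P]_t pois (X t + Y t) k =
  conv (mixed_poisson_pmf P X) (mixed_poisson_pmf P Y) k.
Proof.
(* The absolute value only matters at negative rates, where pois may be
   negative. *)
move=> XY; pose u j (x : R) := `|pois x j|.
have mu j : measurable_fun setT (u j).
  by apply: measurableT_comp => //; exact: measurable_pois.
have u0 j x : 0 <= u j x by exact: normr_ge0.
have uX j t : u j (X t) = pois (X t) j by rewrite /u ger0_norm// pois_ge0.
have uY j t : u j (Y t) = pois (Y t) j by rewrite /u ger0_norm// pois_ge0.
apply: EFin_inj; rewrite /conv -sumEFin.
transitivity (\int[P]_t (\sum_(i < k.+1) (u (k - i)%N (X t) * u i (Y t))%:E))%E.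
  rewrite /Rintegral fineK; last first.
    have XY0 t : 0 <= (X \+ Y : {RV P >-> R}) t by exact: addr_ge0.
    exact: (integrable_fin_num measurableT (integrable_pois XY0 k)).
  apply: eq_integral => t _; rewrite sumEFin -conv_pois; congr EFin.
  by apply: eq_bigr => i _; rewrite uX uY.
rewrite ge0_integral_sum//; last 2 first.
- move=> i; apply/measurable_EFinP; apply: measurable_funM.
    exact: (measurableT_comp (mu _)).
  exact: (measurableT_comp (mu _)).
- by move=> i t _; rewrite lee_fin mulr_ge0.
apply: eq_bigr => i _; rewrite independent_integralM//.
rewrite EFinM !mixed_poisson_pmfE//.
under [X in (X * _)%E]eq_integral do rewrite uX.
under [X in (_ * X)%E]eq_integral do rewrite uY.
rewrite /Rintegral !fineK//; apply: (integrable_fin_num measurableT).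
  exact: (integrable_pois Y0).
exact: (integrable_pois X0).
Qed.

(** The size-bias identity for the test function x |-> pois x k, since x * pois
    x k = (k + 1) * pois x (k + 1). *)
Lemma size_bias_recursion : independent P X Y -> finite_mean P X ->
  'E_P[X]%E != 0%E -> is_size_biased P X P (fun t => X t + Y t) -> forall k,
  k.+1%:R * mixed_poisson_pmf P X k.+1 =
  fine 'E_P[X]%E * conv (mixed_poisson_pmf P X) (mixed_poisson_pmf P Y) k.
Proof.
move=> XY iX EX0 SB k.
have ES t : X t * pois (X t) k = k.+1%:R * pois (X t) k.+1 by rewrite poisS.
have fm : finite_mean P (fun t => X t * pois (X t) k).
  rewrite (_ : (fun t => _) = (fun t => k.+1%:R * pois (X t) k.+1));
    last exact/funext.
  exact: (integrableZl measurableT _ (integrable_pois X0 _)).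
have E : fine 'E_P[(fun t => X t * pois (X t) k)%R]%E =
    k.+1%:R * mixed_poisson_pmf P X k.+1.
  rewrite fine_expectation mixed_poisson_pmfE// -RintegralZl//; last first.
    exact: integrable_pois.
  by apply: eq_Rintegral => t _.
rewrite -mixed_poisson_conv// -fine_expectation -E.
have := SB _ (measurable_pois k) fm.
rewrite -[(fun t => pois (X t + Y t) k)]/((fun x => pois x k) \o
  (fun t => X t + Y t)) => ->.
rewrite /= mulrC divfK//; apply: contra EX0.
by rewrite -fine_eq0// unlock; exact: (integrable_fin_num measurableT iX).
Qed.

End size_bias.

(** * Averaging the Stein equation *)

Section law.
Context {R : realType} d (T : measurableType d) (P : probability T R).

(** Exchange expectation and sum in the decomposition of h(N) along the events N
    = k. *)
Lemma law_tsum (N : {RV P >-> nat}) (p h : nat -> R) :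
  (forall k, P (N @^-1` [set k]) = (p k)%:E) -> finite_mean P (h \o N) ->
  absum (fun k => p k * h k) /\ fine 'E_P[h \o N]%E = tsum (fun k => p k * h k).
Proof.
move=> Np iN.
pose F t k : R := (N t == k)%:R * h k.
have F0 t k : ((N t).+1 <= k)%N -> F t k = 0.
  by move=> Nk; rewrite /F ltn_eqF// mul0r.
have sF (g : nat -> R) t : \sum_(k < (N t).+1) (N t == k)%:R * g k = g (N t).
  rewrite big_ord_recr/= eqxx mul1r big1 ?add0r// => k _.
  by rewrite gtn_eqF ?mul0r.
have NE t k : (N t == k) = (t \in N @^-1` [set k]).
  by apply/eqP/idP; rewrite inE.
have EF t k : F t k = \1_(N @^-1` [set k]) t * h k.
  by rewrite /F indicE NE.
have mN k : measurable (N @^-1` [set k]).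
  by rewrite -[X in measurable X]setTI; exact: measurable_funP.
have i1 k : P.-integrable setT (EFin \o \1_(N @^-1` [set k])).
  exact: integrable_indic.
have IF k : \int[P]_t F t k = p k * h k.
  under eq_Rintegral do rewrite EF.
  rewrite RintegralZr//; congr (_ * _).
  rewrite /Rintegral integral_indic// setIT -[RHS]/(fine (p k)%:E).
  by congr fine; exact: Np.
have [|||_ _ aF E] := @Fubini_count R _ _ P F.
- move=> k; apply: measurable_funM => //.
  rewrite (_ : (fun t => _) = \1_(N @^-1` [set k])); first exact: measurable_indic.
  by apply/funext => t; rewrite indicE NE.
- by move=> t; exact: absum_finite (F0 t).
- apply: eq_integrable (integrable_norm iN) => // t _ /=.
  rewrite (tsum_finite (n := (N t).+1)) => [|k Nk]; last by rewrite F0// normr0.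
  under eq_bigr do rewrite normrM normr_nat.
  by rewrite (sF (fun k => `|h k|)).
- have -> : (fun k => p k * h k) = (fun k => \int[P]_t F t k).
    by apply/funext => k; rewrite IF.
  split=> //; rewrite fine_expectation -E; apply: eq_Rintegral => t _.
  by rewrite (tsum_finite (F0 t)) sF.
Qed.

End law.

Section stein.
Context {R : realType}.
Implicit Types (a p w pe pn f g h : nat -> R) (l C B c : R).

Definition prob_weights p : Prop :=
  [/\ forall k, 0 <= p k, absum p & tsum p = 1].

Lemma prob_weights_bound p g B : prob_weights p -> (forall k, `|g k| <= B) ->
  absum (fun k => p k * g k) /\ `|tsum (fun k => p k * g k)| <= B.
Proof.
move=> [p0 ap p1] gB.
have le k : `|p k * g k| <= B * p k.
  by rewrite normrM ger0_norm// mulrC ler_wpM2r.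
have ag : absum (fun k => p k * g k) by apply: le_absum le _; exact: absumZ.
split=> //; apply: (le_trans (norm_tsum ag)).
rewrite -[B]mulr1 -p1 -tsumZ//; apply: le_tsum => //; first exact: absum_norm.
exact: absumZ.
Qed.

Lemma lipseq_shift C f n : lipseq C f -> lipseq C (fun k => f (k + n)%N).
Proof. by move=> fC k; rewrite addSn. Qed.

(** Moving the argument by k costs at most C k, so absolute convergence at k = 0
    propagates to every k with linear growth. The weights p may have infinite
    mean. *)
Lemma prob_weights_shift p f C k : prob_weights p -> lipseq C f ->
  absum (fun i => p i * f i.+1) ->
  absum (fun i => p i * f (k + i.+1)%N) /\
  tsum (fun i => `|p i * f (k + i.+1)%N|) <=
    tsum (fun i => `|p i * f i.+1|) + C * k%:R.
Proof.
move=> [p0 ap p1] fC af.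
have le i : `|p i * f (k + i.+1)%N| <= `|p i * f i.+1| + C * k%:R * p i.
  rewrite !normrM (ger0_norm (p0 i)) [_ * p i]mulrC -mulrDr ler_wpM2l//.
  rewrite addnC -{1}(subrK (f i.+1) (f (i.+1 + k)%N)) addrC.
  by rewrite (le_trans (ler_normD _ _))// lerD//; exact: lipseq_dist fC.
have ar : absum (fun i => `|p i * f i.+1| + C * k%:R * p i).
  by apply: absumD; [exact: absum_norm|exact: absumZ].
have al : absum (fun i => p i * f (k + i.+1)%N) by exact: le_absum le ar.
split=> //.
apply: (@le_trans _ _ (tsum (fun i => `|p i * f i.+1| + C * k%:R * p i))).
  by apply: le_tsum => //; exact: absum_norm.
by rewrite tsumD ?tsumZ ?p1 ?mulr1//; [exact: absum_norm|exact: absumZ].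
Qed.

(** Here g is the difference of two solutions. The equation and bounded
    increments give k |g(k)| <= l (A + C k), so g is bounded. Beyond K > 2 l the
    factor l / k is at most 1/2, so the bound on g halves at each use of the
    equation and g vanishes there. Downward induction finishes. *)
Lemma stein_unique p l C g :
  prob_weights p -> 0 <= l -> lipseq C g -> g 0%N = 0 ->
  (forall k, absum (fun i => p i * g (k + i.+1)%N)) ->
  (forall k, k%:R * g k = l * tsum (fun i => p i * g (k + i.+1)%N)) ->
  forall k, g k = 0.
Proof.
move=> pp l0 gC g0 ag Eg.
pose A := tsum (fun i => `|p i * g i.+1|).
have A0 : 0 <= A by exact: tsum_ge0.
have C0 := lipseq_ge0 gC.
(* The bound l (A / k + C), with k at least 1. *)
have gB k : `|g k| <= l * (A + C).
  case: k => [|k]; first by rewrite g0 normr0 mulr_ge0// addr_ge0.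
  have k0 : 0 < k.+1%:R :> R by rewrite ltr0n.
  rewrite -(ler_pM2l k0) -{1}(ger0_norm (ltW k0)) -normrM Eg normrM.
  rewrite (ger0_norm l0).
  rewrite mulrCA ler_wpM2l//.
  have [aS] := prob_weights_shift k.+1 pp gC (ag 0%N).
  rewrite -/A => leS; apply: (le_trans (norm_tsum aS)); apply: (le_trans leS).
  rewrite mulrDr [C * _]mulrC lerD2r; apply: ler_peMl => //.
  by rewrite ler1n.
have step k S : (forall j, (k < j)%N -> `|g j| <= S) -> k%:R * `|g k| <= l * S.
  move=> gS; rewrite -{1}(ger0_norm (ler0n R k)) -normrM Eg normrM.
  rewrite (ger0_norm l0).
  rewrite ler_wpM2l//.
  have [|_] := @prob_weights_bound p (fun i => g (k + i.+1)%N) S pp; last by [].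
  by move=> i; apply: gS; rewrite -addSnnS leq_addr.
have [K K1] : exists K : nat, 2 * l + 1 <= K%:R.
  by exists (Num.truncn (2 * l + 1)).+1; apply/ltW/truncnS_gt.
have half n k : (K <= k)%N -> `|g k| <= l * (A + C) / 2 ^+ n.
  elim: n k => [|n IH] k Kk; first by rewrite expr0 divr1.
  have k1 : 2 * l + 1 <= k%:R by rewrite (le_trans K1)// ler_nat.
  have := step k _ (fun j kj => IH j (leq_trans Kk (ltnW kj))).
  set S := _ / 2 ^+ n; have S0 : 0 <= S.
    by rewrite /S !(mulr_ge0, invr_ge0, addr_ge0, exprn_ge0).
  rewrite (_ : _ / _ = S / 2); last first.
    by rewrite /S exprS invfM; ring.
  by move=> h; have := normr_ge0 (g k); nra.
have gK k : (K <= k)%N -> g k = 0.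
  move=> Kk; apply/eqP; rewrite -normr_le0 leNgt; apply/negP => gk.
  set M := l * (A + C) in half.
  (* n > M / |g k|, so 2 ^ n > M / |g k| contradicts the halved bound. *)
  pose n := (Num.truncn (M / `|g k|)).+1; have := half n k Kk.
  rewrite ler_pdivlMr ?exprn_gt0// leNgt => /negP; apply.
  have Mn : M / `|g k| < n%:R by exact: truncnS_gt.
  rewrite mulrC -ltr_pdivrMr// (lt_le_trans Mn)// -natrX ler_nat.
  exact/ltnW/ltn_expl.
have down n k : (K <= k + n)%N -> g k = 0.
  elim: n k => [|n IH] k; first by rewrite addn0; exact: gK.
  move=> Kn; case: k Kn => [//|k Kn].
  have := step k.+1 0; rewrite mulr0 => h.
  have {}h : k.+1%:R * `|g k.+1| <= 0.
    apply: h => j kj; rewrite IH ?normr0//.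
    by rewrite (leq_trans Kn)// -addSnnS leq_add2r.
  by apply/eqP; rewrite -normr_le0; move: h; rewrite pmulr_rle0 ?ltr0n.
by move=> k; apply: (down K); exact: leq_addl.
Qed.

End stein.

Section identity.
Context {R : realType}.
Implicit Types (w pe pn f h : nat -> R) (l C B c : R).

Lemma lipseq_average w f C : prob_weights w -> absum (fun k => k%:R * w k) ->
  lipseq C f ->
  (forall i, absum (fun k => w k * f (k + i)%N)) /\
  lipseq C (fun i => tsum (fun k => w k * f (k + i)%N)).
Proof.
move=> pw aw fC; have [w0 aw1 _] := pw.
have ai i : absum (fun k => w k * f (k + i)%N).
  by apply: (@absum_lipseq _ C (fun k => f (k + i)%N)) => //; exact: lipseq_shift.
split=> // i; rewrite -tsumB//.
under eq_fun do rewrite -mulrBr addnS.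
by have [] := prob_weights_bound pw (fun k => fC (k + i)%N).
Qed.

(** The recursion makes k * w(k) a shifted multiple of a convolution of two
    probability laws, which is summable. *)
Lemma size_biased_mean w pn (l' : R) : prob_weights w -> prob_weights pn ->
  (forall k, k.+1%:R * w k.+1 = l' * conv w pn k) ->
  absum (fun k => k%:R * w k).
Proof.
move=> [w0 aw _] [n0 an _] rec; apply: absum_S; under eq_fun do rewrite rec.
apply: absumZ; suff h : absum2 (fun i j => w j * pn i * 1).
  have := (absum_conv (fun=> 1) w0 n0).2 h; congr absum.
  by apply/funext => n; rewrite mulr1.
split=> [i|].
  by under eq_fun do rewrite mulr1 mulrC; exact: absumZ.
rewrite (_ : (fun i => _) = fun i => tsum w * pn i); first exact: absumZ.
apply/funext => i; rewrite mulrC -tsumZ//; congr tsum; apply/funext => j.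
by rewrite mulr1 ger0_norm ?mulr_ge0// mulrC.
Qed.

(** The Stein equation averaged over w; the term k f(k) is transformed by the
    recursion. All series converge absolutely because k f(k) can be read off
    from the equation itself. *)
Lemma stein_identity w pe pn f h l (l' : R) C c :
  prob_weights w -> prob_weights pe -> prob_weights pn -> 0 <= l -> l' != 0 ->
  (forall k, k.+1%:R * w k.+1 = l' * conv w pn k) ->
  lipseq C f -> (forall k, absum (fun i => pe i * f (k + i.+1)%N)) ->
  (forall k,
    h k - c = l * tsum (fun i => pe i * f (k + i.+1)%N) - k%:R * f k) ->
  absum (fun k => w k * h k) ->
  let G i := tsum (fun k => w k * f (k + i.+1)%N) in
  [/\ lipseq C G, absum (fun i => pe i * G i), absum (fun i => pn i * G i) &
      tsum (fun k => w k * h k) - c =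
      l * tsum (fun i => pe i * G i) - l' * tsum (fun i => pn i * G i)].
Proof.
move=> pw pe' pn' l0 l'0 rec fC ae Ef ah G.
have am := size_biased_mean pw pn' rec.
have [w0 aw w1] := pw; have [n0 an n1] := pn'; have [e0 aew e1] := pe'.
have [aG GC] := lipseq_average pw am fC.
have {}GC : lipseq C G by move=> i; exact: GC.
pose A := tsum (fun i => `|pe i * f i.+1|).
have bE k : tsum (fun i => `|pe i * f (k + i.+1)%N|) <= A + C * k%:R.
  by have [] := prob_weights_shift k pe' fC (ae 0%N).
have C0 := lipseq_ge0 fC.
have A0 : 0 <= A by exact: tsum_ge0.
(* The majorant of E |f(k + 1 + N)|, N with weights pe, is integrable under
   w. *)
have aAC : absum (fun k => w k * (A + C * k%:R)).
  under eq_fun do rewrite mulrDr [w _ * A]mulrC mulrCA [w _ * _]mulrC.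
  by apply: absumD; apply: absumZ.
have De : absum2 (fun k i => w k * (pe i * f (k + i.+1)%N)).
  split=> [k|]; first exact: absumZ.
  apply: le_absum aAC => k; rewrite ger0_norm ?tsum_ge0//.
  under eq_fun do rewrite normrM (ger0_norm (w0 _)).
  by rewrite tsumZ ?ler_wpM2l//; exact: absum_norm.
have [/absum2_tsum aeG' EeG'] := exchange_tsum De.
have EG p i : tsum (fun k => w k * (p i * f (k + i.+1)%N)) = p i * G i.
  by rewrite -tsumZ//; congr tsum; apply/funext => k; ring.
have aeG : absum (fun i => pe i * G i).
  by move: aeG'; under eq_fun do rewrite EG.
have EeG : tsum (fun k => w k * tsum (fun i => pe i * f (k + i.+1)%N)) =
    tsum (fun i => pe i * G i).
  under [in LHS]eq_fun do rewrite -tsumZ//.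
  by rewrite EeG'; congr tsum; apply/funext.
have awE : absum (fun k => w k * tsum (fun i => pe i * f (k + i.+1)%N)).
  apply: le_absum aAC => k; rewrite normrM ger0_norm// ler_wpM2l//.
  by apply: le_trans (bE k); exact: norm_tsum.
(* The Stein equation solved for k f(k). *)
have Ewf k : w k * (k%:R * f k) =
    l * (w k * tsum (fun i => pe i * f (k + i.+1)%N)) - (w k * h k - c * w k).
  have -> : w k * h k - c * w k = w k * (h k - c) by ring.
  by rewrite Ef; ring.
have ahc : absum (fun k => w k * h k - c * w k).
  by apply: absumB => //; exact: absumZ.
have akf : absum (fun k => w k * (k%:R * f k)).
  by under eq_fun do rewrite Ewf; apply: absumB => //; exact: absumZ.
have EkS k : w k.+1 * (k.+1%:R * f k.+1) = l' * (conv w pn k * f k.+1).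
  by rewrite mulrCA mulrA rec mulrA.
have ac : absum (fun k => conv w pn k * f k.+1).
  have := absumZ l'^-1 (absumS akf); congr absum; apply/funext => k.
  by rewrite EkS mulKf.
have [D1 D2] := (absum_conv (fun k => f k.+1) w0 n0).1 ac.
have Ecol i : tsum (fun j => w j * pn i * f (j + i).+1) = pn i * G i.
  by rewrite -tsumZ//; congr tsum; apply/funext => k; rewrite addnS; ring.
have anG : absum (fun i => pn i * G i).
  by have := absum2_tsum (conj D1 D2); under eq_fun do rewrite Ecol.
have Ekf : tsum (fun k => w k * (k%:R * f k)) = l' * tsum (fun i => pn i * G i).
  rewrite tsumS// mul0r mulr0 add0r; under eq_fun do rewrite EkS.
  rewrite tsumZ// tsum_conv//; congr (_ * tsum _); apply/funext => i.
  exact: Ecol.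
split=> //.
have : tsum (fun k => w k * (k%:R * f k)) =
    l * tsum (fun i => pe i * G i) - (tsum (fun k => w k * h k) - c).
  under eq_fun do rewrite Ewf.
  rewrite tsumB//; last exact: absumZ.
  by rewrite tsumZ// EeG tsumB//; [rewrite tsumZ// w1 mulr1|exact: absumZ].
by rewrite Ekf => ->; ring.
Qed.

End identity.

(** * The recursion determines the weights *)

Section recursion.
Context {R : realType}.
Implicit Types (u p : nat -> R).

(** The recursion expresses each value through the preceding ones. *)
Lemma recursion_zero u p l : u 0%N = 0 ->
  (forall k, k.+1%:R * u k.+1 = l * conv u p k) -> forall k, u k = 0.
Proof.
move=> u0 rec k; elim/ltn_ind: k => -[//|k] IH.
have k0 : k.+1%:R != 0 :> R by rewrite pnatr_eq0.
apply: (mulfI k0); rewrite rec mulr0 /conv big1 ?mulr0// => i _.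
by rewrite IH ?mul0r// ltnS leq_subr.
Qed.

(** The combination v(0) u - u(0) v vanishes at 0, hence everywhere. Its sum is
    v(0) - u(0), because both total masses are 1; so u - v vanishes at 0 as
    well, hence everywhere. *)
Lemma recursion_unique u v p l : prob_weights u -> prob_weights v ->
  (forall k, k.+1%:R * u k.+1 = l * conv u p k) ->
  (forall k, k.+1%:R * v k.+1 = l * conv v p k) -> u =1 v.
Proof.
move=> [_ au u1] [_ av v1] ru rv.
(* Linear combinations of u and v satisfy the same recursion. *)
have lin a b : a * u 0%N - b * v 0%N = 0 -> forall k, a * u k - b * v k = 0.
  move=> h; apply: (@recursion_zero (fun k => a * u k - b * v k) p l h) => k.
  rewrite mulrBr mulrCA ru [_ * (b * _)]mulrCA rv mulrCA [b * _]mulrCA.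
  rewrite -mulrBr /conv.
  congr (_ * _); rewrite !mulr_sumr -sumrB; apply: eq_bigr => i _.
  by rewrite mulrBl !mulrA.
(* Summing v(0) u = u(0) v over all indices gives v(0) = u(0). *)
have uv0 : v 0%N = u 0%N.
  have h k : v 0%N * u k = u 0%N * v k.
    by apply/subr0_eq/(lin (v 0%N) (u 0%N)); rewrite mulrC subrr.
  have : tsum (fun k => v 0%N * u k) = tsum (fun k => u 0%N * v k).
    by congr tsum; apply/funext.
  by rewrite !tsumZ// u1 v1 !mulr1.
move=> k; have := lin 1 1; rewrite !mul1r uv0 subrr => /(_ erefl k).
by rewrite !mul1r => /subr0_eq.
Qed.

End recursion.

(** * Wasserstein distance and Poisson averages *)

Section wasserstein.
Context {R : realType} d (T : measurableType d) (P : probability T R)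
  d' (T' : measurableType d') (P' : probability T' R).

Lemma wasserstein_ge0 (X : T -> R) (Y : T' -> R) :
  (0 <= wasserstein P X P' Y)%E.
Proof.
apply: ereal_sup_ubound; exists (fun=> 0).
  split=> [x y||]; first by rewrite subrr normr0.
    exact: (finite_measure_integrable_cst P 0 measurableT).
  exact: (finite_measure_integrable_cst P' 0 measurableT).
by rewrite unlock /= !integral0 sube0 abse0.
Qed.

(** Rescale g to a 1-Lipschitz function; a zero constant makes g constant. *)
Lemma lipschitz_wasserstein (X : T -> R) (Y : T' -> R) (g : R -> R) (C : R) :
  (forall x y, `|g x - g y| <= C * `|x - y|) ->
  finite_mean P (g \o X) -> finite_mean P' (g \o Y) ->
  (`| \int[P]_t g (X t) - \int[P']_t g (Y t) |%:E <=
   C%:E * wasserstein P X P' Y)%E.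
Proof.
move=> gC iX iY.
have C0 : 0 <= C.
  by have := gC 0 1; rewrite sub0r normrN1 mulr1; exact: le_trans.
have [C00|Cn0] := eqVneq C 0.
  have gc x : g x = g 0.
    by apply/subr0_eq/eqP; rewrite -normr_le0 (le_trans (gC _ _))// C00 mul0r.
  rewrite C00 mul0e.
  have -> : (fun t => g (X t)) = fun=> g 0 by exact/funext.
  have -> : (fun t => g (Y t)) = fun=> g 0 by exact/funext.
  by rewrite !Rintegral_prob_cst subrr normr0.
have Cp : 0 < C by rewrite lt0r Cn0.
rewrite -lee_pdivrMl//.
have iX' : finite_mean P ((fun x => C^-1 * g x) \o X).
  exact: (integrableZl measurableT C^-1 iX).
have iY' : finite_mean P' ((fun x => C^-1 * g x) \o Y).
  exact: (integrableZl measurableT C^-1 iY).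
apply: ereal_sup_ubound; exists (fun x => C^-1 * g x).
  split=> // x y.
  by rewrite -mulrBr normrM ger0_norm ?invr_ge0// mulrC ler_pdivrMr// mulrC.
rewrite !expectation_EFin//= -EFinM; congr EFin.
rewrite !RintegralZl// -mulrBr normrM ger0_norm// invr_ge0//.
Qed.

End wasserstein.

Section smooth_wasserstein.
Context {R : realType} d (T : measurableType d) (P : probability T R)
  d' (T' : measurableType d') (P' : probability T' R)
  (X : {RV P >-> R}) (Y : {RV P' >-> R}).
Hypothesis X0 : forall t, 0 <= X t.
Hypothesis Y0 : forall t, 0 <= Y t.

(** The Poisson average is Lipschitz on nonnegative rates only; composing it
    with max(x, 0) gives a function on the line with the same constant, as the
    Wasserstein distance requires. *)
Lemma mixed_poisson_wasserstein (C : R) (G : nat -> R) : lipseq C G ->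
  absum (fun k => mixed_poisson_pmf P X k * G k) ->
  absum (fun k => mixed_poisson_pmf P' Y k * G k) ->
  (`| tsum (fun k => mixed_poisson_pmf P X k * G k) -
      tsum (fun k => mixed_poisson_pmf P' Y k * G k) |%:E <=
   C%:E * wasserstein P X P' Y)%E.
Proof.
move=> GC aX aY.
have [iX <-] := mixed_poisson_smooth X0 GC aX.
have [iY <-] := mixed_poisson_smooth Y0 GC aY.
pose g (x : R) := poisson_smooth G (Num.max x 0).
have m0 (x : R) : 0 <= Num.max x 0 by rewrite le_max lexx orbT.
have gX : g \o X = fun t => poisson_smooth G (X t).
  by apply/funext => t; rewrite /g /= max_l.
have gY : g \o Y = fun t => poisson_smooth G (Y t).
  by apply/funext => t; rewrite /g /= max_l.
rewrite -gX -gY; apply: lipschitz_wasserstein.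
- move=> x y; apply: (le_trans (smooth_lip (m0 x) (m0 y) GC)).
  rewrite ler_wpM2l ?(lipseq_ge0 GC)//.
  have := ler_norm (x - y); have := ler_norm (y - x); rewrite (distrC y).
  rewrite ler_norml; case: (leP x 0) => ?; case: (leP y 0) => ? ? ?;
    by apply/andP; split; lra.
- by rewrite /finite_mean gX.
- by rewrite /finite_mean gY.
Qed.

(** Apply the previous bound to indicator sequences of points, which have
    increments at most 1. *)
Lemma wasserstein_eq0 : wasserstein P X P' Y = 0%E ->
  mixed_poisson_pmf P X =1 mixed_poisson_pmf P' Y.
Proof.
move=> W0 j; pose G k : R := (k == j)%:R.
have GC : lipseq 1 G.
  move=> k; rewrite /G; do 2 case: eqP => _;
    by rewrite ?subrr ?subr0 ?sub0r ?normrN ?normr1 ?normr0.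
have pG p : absum (fun k => p k * G k) /\ tsum (fun k => p k * G k) = p j.
  have z k : (j.+1 <= k)%N -> p k * G k = 0.
    by move=> jk; rewrite /G gtn_eqF ?mulr0.
  split; first exact: absum_finite z.
  rewrite (tsum_finite z) big_ord_recr/= /G eqxx mulr1 big1 ?add0r// => k _.
  by rewrite ltn_eqF ?mulr0.
have [aX EX] := pG (mixed_poisson_pmf P X).
have [aY EY] := pG (mixed_poisson_pmf P' Y).
have := mixed_poisson_wasserstein GC aX aY.
by rewrite W0 mule0 lee_fin EX EY normr_le0 subr_eq0 => /eqP.
Qed.

End smooth_wasserstein.

(** * Solutions of the Stein equation *)

Section supnorm.
Context {R : realType}.
Implicit Types (f : nat -> R).

Lemma supnorm_ge f k : (`|f k|%:E <= supnorm f)%E.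
Proof. by apply: ereal_sup_ubound; exists k. Qed.

Lemma supnorm_ge0 f : (0 <= supnorm f)%E.
Proof. by apply: le_trans (supnorm_ge f 0); rewrite lee_fin. Qed.

Lemma supnorm_le f B : (forall k, `|f k| <= B) -> (supnorm f <= B%:E)%E.
Proof. by move=> fB; apply: ge_ereal_sup => _ [k _ <-]; rewrite lee_fin. Qed.

Lemma supnorm_fin f : (supnorm f < +oo)%E ->
  exists B, supnorm f = B%:E /\ forall k, `|f k| <= B.
Proof.
move=> foo; exists (fine (supnorm f)).
have E : supnorm f = (fine (supnorm f))%:E.
  by rewrite fineK// ge0_fin_numE ?supnorm_ge0.
by split=> // k; rewrite -lee_fin -E; exact: supnorm_ge.
Qed.

Lemma supnorm_forward_diff f :
  (supnorm f < +oo)%E -> (supnorm (forward_diff f) < +oo)%E.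
Proof.
move=> /supnorm_fin[B [_ fB]].
apply: (@le_lt_trans _ _ (B + B)%:E); last exact: ltry.
apply: supnorm_le => k; rewrite (le_trans (ler_normB _ _))// lerD//.
Qed.

Lemma supnorm_lipseq f : (supnorm (forward_diff f) < +oo)%E ->
  exists C, supnorm (forward_diff f) = C%:E /\ lipseq C f.
Proof. by move=> /supnorm_fin[C [E fC]]; exists C. Qed.

End supnorm.

Section solutions.
Context {R : realType} d (T : measurableType d) (P : probability T R)
  d' (T' : measurableType d') (P' : probability T' R)
  (xi eta : {RV P >-> R}) (Z : {RV P' >-> nat}) (h : nat -> R).
Local Notation pe := (mixed_poisson_pmf P eta).
Hypothesis eta0 : forall t, 0 <= eta t.
Hypothesis xi_mean : 0 <= fine 'E_P[xi]%E.

Lemma mixed_poisson_weights d1 (T1 : measurableType d1) (P1 : probability T1 R)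
  (X : {RV P1 >-> R}) :
  (forall t, 0 <= X t) -> prob_weights (mixed_poisson_pmf P1 X).
Proof.
move=> X0; have [aX X1] := mixed_poisson_total X0.
by split=> // k; exact: mixed_poisson_pmf_ge0.
Qed.

Lemma stein_equation_tsum f : stein_equation P xi eta P' Z h f -> forall k,
  absum (fun i => pe i * f (k + i.+1)%N) /\
  h k - fine 'E_P'[h \o Z]%E =
    fine 'E_P[xi]%E * tsum (fun i => pe i * f (k + i.+1)%N) - k%:R * f k.
Proof. by move=> /[swap] k /(_ k)[/absum_cvg ac]; rewrite tsum_lim. Qed.

Lemma stein_solution_unique f g C C' : lipseq C f -> lipseq C' g ->
  f 0%N = 0 -> g 0%N = 0 ->
  stein_equation P xi eta P' Z h f -> stein_equation P xi eta P' Z h g -> f = g.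
Proof.
move=> fC gC f0 g0 /stein_equation_tsum Ef /stein_equation_tsum Eg.
apply/funext => k; apply/subr0_eq; move: k.
apply: (@stein_unique _ pe (fine 'E_P[xi]%E) (C + C')) => //.
- exact: mixed_poisson_weights.
- move=> k; rewrite (_ : _ - _ = (f k.+1 - f k) - (g k.+1 - g k)); last by ring.
  by rewrite (le_trans (ler_normB _ _))// lerD.
- by rewrite f0 g0 subr0.
- move=> k; have [af _] := Ef k; have [ag _] := Eg k.
  by have := absumB af ag; congr absum; apply/funext => i; rewrite mulrBr.
- move=> k; have [af Efk] := Ef k; have [ag Egk] := Eg k.
  under eq_fun do rewrite mulrBr.
  rewrite tsumB// mulrBr mulrBr; lra.
Qed.

End solutions.
Local Open Scope ereal_scope.

(** * The comparison bound *)

Section stein_comparison.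
Context (R : realType) (d1 d2 d3 d4 : measure_display)
    (T1 : measurableType d1) (P1 : probability T1 R)
    (T2 : measurableType d2) (P2 : probability T2 R)
    (T3 : measurableType d3) (P3 : probability T3 R)
    (T4 : measurableType d4) (P4 : probability T4 R)
    (xi eta : {RV P1 >-> R}) (mu nu : {RV P2 >-> R})
    (Z : {RV P3 >-> nat}) (W : {RV P4 >-> nat}).
Hypotheses (xi_ge0 : forall t, (0 <= xi t)%R)
    (mu_ge0 : forall t, (0 <= mu t)%R)
    (xi_mean : finite_mean P1 xi) (xi_mean_neq0 : 'E_P1[xi] != 0)
    (mu_mean : finite_mean P2 mu) (mu_mean_neq0 : 'E_P2[mu] != 0)
    (eta_ge0 : forall t, (0 <= eta t)%R)
    (nu_ge0 : forall t, (0 <= nu t)%R)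
    (xi_eta_indep : independent P1 xi eta)
    (mu_nu_indep : independent P2 mu nu)
    (xi_size_bias : is_size_biased P1 xi P1 (fun t => xi t + eta t)%R)
    (mu_size_bias : is_size_biased P2 mu P2 (fun t => mu t + nu t)%R)
    (Z_MP : mixed_poisson P1 xi P3 Z)
    (W_MP : mixed_poisson P2 mu P4 W).
Variable h : nat -> R.
Hypotheses (hZ : finite_mean P3 (h \o Z)) (hW : finite_mean P4 (h \o W)).

(** The solution f need not be bounded: when the means differ and f is unbounded
    the bound is infinite, and when they agree the last term is zero. *)
Lemma stein_solution_bound f C : lipseq C f -> f 0%N = 0%R ->
  stein_equation P1 xi eta P3 Z h f ->
  `| 'E_P4[h \o W] - 'E_P3[h \o Z] | <=
  'E_P1[xi] * C%:E * wasserstein P2 nu P1 eta +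
  supnorm f * `| 'E_P2[mu] - 'E_P1[xi] |.
Proof.
move=> fC f0 Ef.
have [l l0 El] := mean_gt0 xi_ge0 xi_mean xi_mean_neq0.
have [m m0 Em] := mean_gt0 mu_ge0 mu_mean mu_mean_neq0.
have {}Ef := stein_equation_tsum Ef.
have rec := size_bias_recursion mu_ge0 nu_ge0 mu_nu_indep mu_mean
  mu_mean_neq0 mu_size_bias.
have [aWh EWh] := law_tsum W_MP hW.
have mneq0 : fine 'E_P2[mu] != 0%R by rewrite Em gt_eqF.
have lge0 : (0 <= fine 'E_P1[xi])%R by rewrite El ltW.
have pw := mixed_poisson_weights mu_ge0.
have pe := mixed_poisson_weights eta_ge0.
have pn := mixed_poisson_weights nu_ge0.
have [GC aeG anG E] := stein_identity pw pe pn lge0 mneq0 rec fC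
  (fun k => (Ef k).1) (fun k => (Ef k).2) aWh.
set G := (fun i => tsum _) in GC aeG anG E.
have B := mixed_poisson_wasserstein nu_ge0 eta_ge0 GC anG aeG.
set TN := tsum (fun i => mixed_poisson_pmf P2 nu i * G i)%R in E B.
set TE := tsum (fun i => mixed_poisson_pmf P1 eta i * G i)%R in E B.
have TNB B' : (forall k, `|f k| <= B')%R -> (`|TN| <= B')%R.
  move=> fB; suff GB k : (`|G k| <= B')%R by have [] := prob_weights_bound pn GB.
  by have [_] := prob_weights_bound pw (fun j => fB (j + k.+1)%N).
have -> : 'E_P4[h \o W] - 'E_P3[h \o Z] = (l * (TE - TN) + (l - m) * TN)%:E.
  rewrite !expectation_EFin// -!fine_expectation -EFinB EWh E El Em /=.
  by congr EFin; ring.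
rewrite El Em -EFinB !abse_EFin.
apply: (@le_trans _ _ (l%:E * `|TN - TE|%:E + `|TN|%:E * `|m - l|%:E)).
  rewrite -!EFinM -EFinD lee_fin (le_trans (ler_normD _ _))// !normrM.
  by rewrite (gtr0_norm l0) (distrC TE) (distrC l) [(_ * `|TN|)%R]mulrC.
apply: leeD.
  by rewrite -muleA lee_pmul2l// ?lte_fin.
have [->|ml] := eqVneq m l; first by rewrite subrr normr0 !mule0.
have [|foo] := ltP (supnorm f) +oo.
  move=> /supnorm_fin[B' [-> fB]].
  by rewrite -!EFinM lee_fin ler_wpM2r// TNB.
have -> : supnorm f = +oo by apply/eqP; rewrite -leye_eq.
by rewrite gt0_mulye ?leey// lte_fin normr_gt0 subr_eq0.
Qed.

(** Either a solution with bounded increments exists and attains both infima,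
    being unique, or both infima are infinite. *)
Lemma stein_factor_bound :
  `| 'E_P4[h \o W] - 'E_P3[h \o Z] | <=
  'E_P1[xi] * ereal_inf [set supnorm (forward_diff f) |
      f in stein_solutions P1 xi eta P3 Z h] *
    wasserstein P2 nu P1 eta +
  ereal_inf [set supnorm f | f in stein_solutions P1 xi eta P3 Z h]
    * `| 'E_P2[mu] - 'E_P1[xi] |.
Proof.
have [l l0 El] := mean_gt0 xi_ge0 xi_mean xi_mean_neq0.
have [m m0 Em] := mean_gt0 mu_ge0 mu_mean mu_mean_neq0.
have lge0 : (0 <= fine 'E_P1[xi])%R by rewrite El ltW.
set S := stein_solutions _ _ _ _ _ _.
have Eye : 0 <= 'E_P1[xi] by rewrite El lee_fin ltW.
have W0 := wasserstein_ge0 P2 P1 nu eta.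
have [[f Sf fD]|noS] := pselect (exists2 f, S f & supnorm (forward_diff f) < +oo).
  have [C [EC fC]] := supnorm_lipseq fD.
  have [[f0 Ef] _] := Sf.
  apply: (le_trans (stein_solution_bound fC f0 Ef)).
  have U g : S g -> supnorm (forward_diff g) < +oo -> g = f.
    move=> [[g0 Eg] _] /supnorm_lipseq[C' [_ gC]].
    exact: (stein_solution_unique eta_ge0 lge0 gC fC g0 f0 Eg Ef).
  have H1 : C%:E <= ereal_inf [set supnorm (forward_diff f) | f in S].
    apply: le_ereal_inf_tmp => _ [g Sg <-]; rewrite -EC.
    have [gD|] := ltP (supnorm (forward_diff g)) +oo; first by rewrite (U g).
    by move=> goo; apply: le_trans goo; exact: leey.
  have H0 : supnorm f <= ereal_inf [set supnorm f | f in S].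
    apply: le_ereal_inf_tmp => _ [g Sg <-].
    have [gD|] := ltP (supnorm g) +oo; last by move=> goo; apply: le_trans goo; exact: leey.
    by rewrite (U g)//; exact: supnorm_forward_diff.
  apply: leeD; last exact: lee_wpmul2r.
  by rewrite lee_wpmul2r// lee_wpmul2l.
have D1 : ereal_inf [set supnorm (forward_diff f) | f in S] = +oo.
  apply/eqP; rewrite -leye_eq; apply: le_ereal_inf_tmp => _ [g Sg <-].
  by rewrite leNgt; apply/negP => gD; apply: noS; exists g.
have D0 : ereal_inf [set supnorm f | f in S] = +oo.
  apply/eqP; rewrite -leye_eq; apply: le_ereal_inf_tmp => _ [g Sg <-].
  rewrite leNgt; apply/negP => gD; apply: noS; exists g => //.
  exact: supnorm_forward_diff.
rewrite D1 D0 El Em gt0_muley ?lte_fin// -EFinB abse_EFin.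
(* Different means: the second term of the bound is infinite. *)
have [ml|ml] := eqVneq m l; last first.
  rewrite [X in _ <= _ + X]gt0_mulye ?lte_fin ?normr_gt0 ?subr_eq0//.
  by rewrite addey ?leey// gt_eqF// (lt_le_trans (ltNyr 0))// mule_ge0// leey.
rewrite ml subrr normr0 mule0 adde0.
have [W00|Wn0] := eqVneq (wasserstein P2 nu P1 eta) 0; last first.
  by rewrite gt0_mulye ?leey// lt0e Wn0.
rewrite W00 mule0.
(* Equal means and zero distance: W and Z have the same weights. *)
have pne := wasserstein_eq0 nu_ge0 eta_ge0 W00.
have recW := size_bias_recursion mu_ge0 nu_ge0 mu_nu_indep mu_mean
  mu_mean_neq0 mu_size_bias.
have recZ := size_bias_recursion xi_ge0 eta_ge0 xi_eta_indep xi_mean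
  xi_mean_neq0 xi_size_bias.
have WZ : mixed_poisson_pmf P2 mu =1 mixed_poisson_pmf P1 xi.
  apply: (recursion_unique (mixed_poisson_weights mu_ge0)
    (mixed_poisson_weights xi_ge0) (l := l) (p := mixed_poisson_pmf P1 eta)) => k.
    by rewrite recW Em ml (funext pne).
  by rewrite recZ El.
have [_ EWh] := law_tsum W_MP hW.
have [_ EZh] := law_tsum Z_MP hZ.
rewrite !expectation_EFin// -!fine_expectation -EFinB EWh EZh (funext WZ) subrr.
by rewrite abse0.
Qed.

End stein_comparison.

Theorem theorem2 (R : realType) (d1 d2 d3 d4 : measure_display)
    (T1 : measurableType d1) (P1 : probability T1 R)
    (T2 : measurableType d2) (P2 : probability T2 R)
    (T3 : measurableType d3) (P3 : probability T3 R)
    (T4 : measurableType d4) (P4 : probability T4 R)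
    (xi eta : {RV P1 >-> R}) (mu nu : {RV P2 >-> R})
    (Z : {RV P3 >-> nat}) (W : {RV P4 >-> nat})
    (H : set (nat -> R))
    (xi_ge0 : forall t, (0 <= xi t)%R)
    (mu_ge0 : forall t, (0 <= mu t)%R)
    (xi_infdiv : infinitely_divisible P1 xi)
    (mu_infdiv : infinitely_divisible P2 mu)
    (xi_mean : finite_mean P1 xi) (xi_mean_neq0 : 'E_P1[xi] != 0)
    (mu_mean : finite_mean P2 mu) (mu_mean_neq0 : 'E_P2[mu] != 0)
    (eta_ge0 : forall t, (0 <= eta t)%R)
    (nu_ge0 : forall t, (0 <= nu t)%R)
    (xi_eta_indep : independent P1 xi eta)
    (mu_nu_indep : independent P2 mu nu)
    (xi_size_bias : is_size_biased P1 xi P1 (fun t => xi t + eta t)%R)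
    (mu_size_bias : is_size_biased P2 mu P2 (fun t => mu t + nu t)%R)
    (Z_MP : mixed_poisson P1 xi P3 Z)
    (W_MP : mixed_poisson P2 mu P4 W)
    (H_mean : forall h, H h ->
       finite_mean P3 (h \o Z) /\ finite_mean P4 (h \o W)) :
  ereal_sup [set `| 'E_P4[h \o W] - 'E_P3[h \o Z] | | h in H] <=
  'E_P1[xi] * stein_factor1 P1 xi eta P3 Z H * wasserstein P2 nu P1 eta +
  stein_factor0 P1 xi eta P3 Z H * `| 'E_P2[mu] - 'E_P1[xi] |.
Proof.
apply: ge_ereal_sup => _ [h Hh <-]; have [hZ hW] := H_mean h Hh.
apply: (le_trans (stein_factor_bound xi_ge0 mu_ge0 xi_mean xi_mean_neq0 mu_mean
  mu_mean_neq0 eta_ge0 nu_ge0 xi_eta_indep mu_nu_indep xi_size_bias mu_size_bias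
  Z_MP W_MP hZ hW)).
have [l l0 El] := mean_gt0 xi_ge0 xi_mean xi_mean_neq0.
apply: leeD; apply: lee_wpmul2r => //; first exact: wasserstein_ge0.
  rewrite El; apply: lee_wpmul2l; first by rewrite lee_fin ltW.
  by apply: ereal_sup_ubound; exists h.
by apply: ereal_sup_ubound; exists h.
Qed.
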